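(* Let $q=3^r$ with $r\ge 1$, and let $d\ge 2$ satisfy $d\equiv 2\pmod 3$. On $\mathbb F_q^d$, let $Q(x)=x_1^2+\cdots+x_d^2$, let $e_1,\ldots,e_d$ be the standard basis, and let $\mathbf 1=(1,\ldots,1)$. For $1\le i<j\le d$ define $u_{ij}=\mathbf 1-2e_i-2e_j$ (so $u_{ij}$ has entries $-1$ in positions $i,j$ and entries $1$ elsewhere), and for $1\le i\le d$ define $v_i=-\mathbf 1+2e_i$ (so $v_i$ has entry $1$ in position $i$ and entries $-1$ elsewhere). Put $$S_d=\{0,\mathbf 1\}\cup\{\pm e_i:1\le i\le d\}\cup\{u_{ij}:1\le i<j\le d\}\cup\{v_i:1\le i\le d\}.$$ Then $S_d$ is a two-distance set with nonzero squared distances $1,2\in\mathbb F_q$, and $$|S_d|=\binom{d+2}{2}+d+1.$$ Consequently, the upper bound $|S|\le\binom{d+2}{2}+d+1$, valid for every two-distance set $S$ in $\mathbb F_q^d$ with two distinct nonzero squared distances, is attained in infinitely many dimensions $d$.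
   Context: A set $S\subseteq\mathbb F_q^d$ is a two-distance set if $Q(x-y)$, over distinct $x,y\in S$, takes exactly two values; these values are called its squared distances. The bound $|S|\le\binom{d+2}{2}+d+1$ for two-distance sets with distinct nonzero squared distances (over any field of characteristic different from $2$) is referred to as the Larman--Rogers--Seidel bound. *)

(* Defs.v *)
From mathcomp Require Import all_boot all_algebra.

Set Implicit Arguments.
Unset Strict Implicit.
Unset Printing Implicit Defensive.

Import GRing.Theory.
Local Open Scope ring_scope.

Definition Q (F : fieldType) (d : nat) (x : 'rV[F]_d) : F :=
  \sum_(i < d) x 0 i ^+ 2.

Definition sq_dists (F : finFieldType) (d : nat) (S : {set 'rV[F]_d}) : {set F} :=
  [set Q (x - y) | x in S, y in S & x != y].

Definition two_distance (F : finFieldType) (d : nat) (S : {set 'rV[F]_d}) : Prop :=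
  #|sq_dists S| = 2%N.

Definition stdvec (F : fieldType) (d : nat) (i : 'I_d) : 'rV[F]_d := delta_mx 0 i.

Definition ones (F : fieldType) (d : nat) : 'rV[F]_d := const_mx 1.

Definition uvec (F : fieldType) (d : nat) (i j : 'I_d) : 'rV[F]_d :=
  ones F d - 2 *: stdvec F i - 2 *: stdvec F j.

Definition vvec (F : fieldType) (d : nat) (i : 'I_d) : 'rV[F]_d :=
  - ones F d + 2 *: stdvec F i.

Definition Sd (F : finFieldType) (d : nat) : {set 'rV[F]_d} :=
  [set 0; ones F d]
  :|: ([set stdvec F i | i : 'I_d] :|: [set - stdvec F i | i : 'I_d])
  :|: [set uvec F i j | i in 'I_d, j in 'I_d & (i < j)%N]
  :|: [set vvec F i | i : 'I_d].

(* The Larman--Rogers--Seidel bound in dimension d. *)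
Definition LRS_bound (d : nat) : nat := ('C(d + 2, 2) + d + 1)%N.

(* Main.v *)
(* Upper bound: if a, b are the distances, (Q(x-y)-a)(Q(x-y)-b) equals a*b when
   x = y and vanishes at distinct points of S. As a function of y it lies in the
   span of Q(y)^2, the Q(y) y_i and the monomials of degree at most 2, which are
   C(d+2,2)+d+1 functions, so the scalar matrix a*b has at most that rank.

   Construction: let j be the all-ones vector, w_0 = -j and w_i = e_i for
   1 <= i <= d. As 2 = -1 in F, the set consists of the j + w_a + w_b for the
   pairs {a,b} in {0,..,d}, and of the -w_a and -j - w_a. All these have
   coefficient sum -1 on the w_i, and Q(a j + sum c_i w_i) = sum c_i^2 - a^2
   whenever the c_i sum to 0, so the symmetric group on {0,..,d} acts by
   isometries and only a few types of differences remain. *)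
Require Import Defs.
From mathcomp Require Import all_boot all_algebra.
From mathcomp Require Import finfield ring.

Set Implicit Arguments.
Unset Strict Implicit.
Unset Printing Implicit Defensive.

Import GRing.Theory.
Local Open Scope ring_scope.

(** * Upper bound by a rank argument *)

(** The matrix product of [A] and [B] is [c] times the identity of size |S|, hence of rank |S|, and
    it factors through a space of dimension |I|. *)
Lemma leq_card_scalar_factor (F : fieldType) (T I : finType) (S : {set T})
    (A : T -> I -> F) (B : I -> T -> F) (c : F) :
  c != 0 ->
  (forall x y, x \in S -> y \in S ->
     \sum_k A x k * B k y = (if x == y then c else 0)) ->
  (#|S| <= #|I|)%N.
Proof.
move=> c0 AB.
pose MA := \matrix_(i < #|S|, k < #|I|) A (enum_val i) (enum_val k).
pose MB := \matrix_(k < #|I|, j < #|S|) B (enum_val k) (enum_val j).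
have E : MA *m MB = c%:M.
  apply/matrixP => i j; rewrite !mxE.
  have := AB _ _ (enum_valP i) (enum_valP j).
  rewrite (inj_eq enum_val_inj) big_enum_val => E.
  under eq_bigr do rewrite !mxE.
  by rewrite E -val_eqE; case: (_ == _); rewrite ?mulr1n ?mulr0n.
have rk : \rank (MA *m MB) = #|S|.
  by rewrite E -scalemx1 (eqmx_scale _ c0) mxrank1.
by rewrite -rk (leq_trans (mxrankM_maxl _ _)) ?rank_leq_col.
Qed.

Lemma card_ord_pairs (n : nat) :
  #|[pred p : 'I_n * 'I_n | (p.1 <= p.2)%N]| = 'C(n.+1, 2).
Proof.
rewrite -sum1_card.
rewrite (eq_bigl (fun p : 'I_n * 'I_n => xpredT p.2 && (p.1 <= p.2)%N)) //.
rewrite -(pair_big_dep xpredT (fun i j : 'I_n => (i <= j)%N) (fun _ _ => 1%N)).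
rewrite (exchange_big_dep xpredT) //= -bin2_sum big_nat_recl // add0n big_mkord.
apply: eq_bigr => j _.
by rewrite -(big_ord_widen n (fun=> 1%N) (ltn_ord j)) sum1_card card_ord.
Qed.

(** Each term below the diagonal joins its transpose, so that a symmetric product such as y_i y_j is
    counted only once. *)
Lemma sum_ord_pairs (V : zmodType) (n : nat) (g : 'I_n -> 'I_n -> V) :
  \sum_i \sum_j g i j =
  \sum_(p : 'I_n * 'I_n | (p.1 <= p.2)%N)
     (g p.1 p.2 + g p.2 p.1 *+ (p.1 < p.2)%N).
Proof.
rewrite big_split /= pair_bigA /=.
rewrite (bigID (fun p : 'I_n * 'I_n => (p.1 <= p.2)%N)) /=.
congr (_ + _).
under [RHS]eq_bigr do rewrite mulrb.
rewrite -big_mkcondr /=.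
rewrite (reindex (fun p : 'I_n * 'I_n => (p.2, p.1))) /=; last first.
  by exists (fun p => (p.2, p.1)) => -[].
by apply: eq_bigl => p; rewrite -ltnNge ltn_neqAle; case: (p.1 <= p.2)%N;
  rewrite ?andbF ?andbT.
Qed.

(* The (d+1)-tuple (a, c_1, .., c_d); a monomial of degree at most 2 in y is a
   product of two entries of (1, y_1, .., y_d). *)
Definition ocons (F : fieldType) (d : nat) (a : F) (c : 'I_d -> F) :
  'I_d.+1 -> F := oapp c a \o unlift ord0.

Lemma ocons0 (F : fieldType) (d : nat) (a : F) (c : 'I_d -> F) :
  ocons a c ord0 = a.
Proof. by rewrite /ocons /= unlift_none. Qed.

Lemma oconsS (F : fieldType) (d : nat) (a : F) (c : 'I_d -> F) (i : 'I_d) :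
  ocons a c (lift ord0 i) = c i.
Proof. by rewrite /ocons /= liftK. Qed.

Lemma sum_ocons (F : fieldType) (d : nat) (a b : F) (c e : 'I_d -> F) :
  \sum_i ocons a c i * ocons b e i = a * b + \sum_i c i * e i.
Proof.
rewrite big_ord_recl !ocons0; congr (_ + _).
by apply: eq_bigr => i _; rewrite !oconsS.
Qed.

Lemma Q_sub (F : fieldType) (d : nat) (x y : 'rV[F]_d) :
  Q (x - y) = Q x - 2 * (\sum_i x 0 i * y 0 i) + Q y.
Proof.
rewrite /Q mulr_sumr -sumrB -big_split /=; apply: eq_bigr => i _.
by rewrite !mxE; ring.
Qed.

Lemma LRS_upper_bound (F : finFieldType) (d : nat) (S : {set 'rV[F]_d}) :
  two_distance S -> 0 \notin sq_dists S -> (#|S| <= LRS_bound d)%N.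
Proof.
move=> /eqP /cards2P[a [b] /= [_ dE]]; rewrite dE !inE negb_or => /andP[a0 b0].
pose P := [pred p : 'I_d.+1 * 'I_d.+1 | (p.1 <= p.2)%N].
(* One function Q(y)^2, d functions Q(y) y_i, and one product of two entries of (1, y) for each pair
   in [P]. *)
have -> : LRS_bound d = #|{: 'I_1 + 'I_d + 'I_#|P|}|.
  by rewrite !card_sum !card_ord card_ord_pairs /LRS_bound addn2; ring.
(* Q x - 2 x.y - a = al . (1, y) and Q x - 2 x.y - b = be . (1, y), while de
   collects the coefficient of Q y = sum y_i^2. *)
pose al (x : 'rV[F]_d) := ocons (Q x - a) (fun i => - 2 * x 0 i).
pose be (x : 'rV[F]_d) := ocons (Q x - b) (fun i => - 2 * x 0 i).
pose de (x : 'rV[F]_d) :=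
  ocons (d := d) 0 (fun=> 2 * Q x - a - b).
(* With L_a = Q(x) - 2 x.y - a and L_b likewise, the target is Q(y)^2 + Q(y) (L_a + L_b) + L_a L_b.
   The part -4 x.y of L_a + L_b uses the Q(y) y_i; the constant part 2 Q(x) - a - b times Q(y) is
   quadratic and enters the diagonal of [c]. *)
pose c x i j := al x i * be x j + de x i *+ (i == j).
pose h (y : 'rV[F]_d) := ocons 1 (y 0).
pose A (x : 'rV[F]_d) (k : 'I_1 + 'I_d + 'I_#|P|) := match k with
  | inl (inl _) => 1
  | inl (inr i) => - 4 * x 0 i
  | inr k => let p := enum_val k in
      c x p.1 p.2 + c x p.2 p.1 *+ (p.1 < p.2)%N
  end.
pose B (k : 'I_1 + 'I_d + 'I_#|P|) (y : 'rV[F]_d) := match k with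
  | inl (inl _) => Q y ^+ 2
  | inl (inr i) => Q y * y 0 i
  | inr k => let p := enum_val k in h y p.1 * h y p.2
  end.
have AB x y : \sum_k A x k * B k y = (Q (x - y) - a) * (Q (x - y) - b).
  rewrite !big_sumType /= big_ord1 /=.
  rewrite -(big_enum_val (A := P) (fun p =>
    (c x p.1 p.2 + c x p.2 p.1 *+ (p.1 < p.2)%N) * (h y p.1 * h y p.2))) /=.
  have -> : \sum_(p in P)
      (c x p.1 p.2 + c x p.2 p.1 *+ (p.1 < p.2)%N) * (h y p.1 * h y p.2) =
    \sum_i \sum_j c x i j * (h y i * h y j).
    rewrite sum_ord_pairs; apply: eq_bigr => p _.
    by rewrite mulrDl mulrnAl [h y p.2 * _]mulrC.
  have -> : \sum_i \sum_j c x i j * (h y i * h y j) =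
    (\sum_i al x i * h y i) * (\sum_i be x i * h y i) +
    \sum_i de x i * (h y i * h y i).
    rewrite big_distrl -big_split /=; apply: eq_bigr => i _.
    rewrite big_distrr /=.
    rewrite [in RHS](_ : de x i * _ =
      \sum_j (de x i *+ (i == j)) * (h y i * h y j)); last first.
      rewrite (bigD1 i) //= eqxx mulr1n big1 ?addr0 // => j /negPf.
      by rewrite eq_sym => ->; rewrite mul0r.
    by rewrite -big_split /=; apply: eq_bigr => j _; rewrite /c mulrDl mulrACA.
  rewrite !sum_ocons big_ord_recl /de ocons0.
  have -> : \sum_i -2 * x 0 i * y 0 i = -2 * \sum_i x 0 i * y 0 i.
    by rewrite mulr_sumr; apply: eq_bigr => i _; rewrite mulrA.
  have -> : \sum_i -4 * x 0 i * (Q y * y 0 i) =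
      -4 * Q y * \sum_i x 0 i * y 0 i.
    by rewrite mulr_sumr; apply: eq_bigr => i _; ring.
  have -> : \sum_(i < d) ocons 0 (fun=> 2 * Q x - a - b) (lift ord0 i) *
      (h y (lift ord0 i) * h y (lift ord0 i)) = (2 * Q x - a - b) * Q y.
    by rewrite /Q [RHS]mulr_sumr; apply: eq_bigr => i _; rewrite /h !oconsS.
  rewrite Q_sub; ring.
apply: (leq_card_scalar_factor (A := A) (B := B) (c := a * b));
  rewrite ?mulf_neq0 1?eq_sym //.
move=> x y xS yS; rewrite [LHS]AB; case: eqVneq => [->|xy].
  rewrite subrr (_ : Q 0 = 0) ?sub0r ?mulrNN // /Q big1 // => i _.
  by rewrite mxE expr0n.
have : Q (x - y) \in [set a; b].
  by rewrite -dE; apply/imset2P; exists x y; rewrite ?inE ?yS.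
by rewrite !inE => /orP[]/eqP->; rewrite subrr ?mul0r ?mulr0.
Qed.

(* The combination a j + sum c_i w_i of the header. *)
Definition comb_vec (F : fieldType) (d : nat) (a : F) (c : 'I_d.+1 -> F) :
  'rV[F]_d := \row_j (a - c ord0 + c (lift ord0 j)).

Lemma comb_vecB (F : fieldType) (d : nat) (a b : F) (c e : 'I_d.+1 -> F) :
  comb_vec a c - comb_vec b e = comb_vec (a - b) (fun i => c i - e i).
Proof. by apply/rowP => j; rewrite !mxE; ring. Qed.

(** * Squared distances of the construction in characteristic 3 *)

Section Char3.
Variables (F : finFieldType) (d : nat).
Hypotheses (three0 : 3 = 0 :> F) (d2 : d%:R = 2 :> F).

(** Brings 3 = 0 into [ring] computations: [z] certifies that the two sides differ by a multiple of
    3. *)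
Lemma eq_mod3 (x y z : F) : x - y = 3 * z -> x = y.
Proof. by rewrite three0 mul0r; apply: subr0_eq. Qed.

Lemma two_neq0 : 2 != 0 :> F.
Proof.
apply/eqP => two0; have /eqP[] := oner_neq0 F.
have -> : 1 = 3 - 2 :> F by ring.
by rewrite three0 two0 subr0.
Qed.

(** The squares of a - c_0 + c_j expand to d (a - c_0)^2 + 2 (a - c_0) sum c_j + sum c_j^2 over j >=
    1. Since d = 2 and sum c_j = -c_0, this exceeds the claim by 3 (a - c_0)^2. *)
Lemma Q_comb_vec (a : F) (c : 'I_d.+1 -> F) :
  \sum_i c i = 0 -> Q (comb_vec a c) = \sum_i c i ^+ 2 - a ^+ 2.
Proof.
rewrite !big_ord_recl => /eqP; rewrite addrC addr_eq0 => /eqP c0.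
transitivity (d%:R * (a - c ord0) ^+ 2 +
   2 * (a - c ord0) * (\sum_(i < d) c (lift ord0 i)) +
   \sum_(i < d) c (lift ord0 i) ^+ 2).
  have -> : d%:R * (a - c ord0) ^+ 2 = \sum_(i < d) (a - c ord0) ^+ 2.
    by rewrite sumr_const card_ord mulr_natl.
  rewrite mulr_sumr -!big_split /=.
  by apply: eq_bigr => j _; rewrite !mxE; ring.
by rewrite c0 d2; apply: (eq_mod3 (z := (a - c ord0) ^+ 2)); ring.
Qed.

(** Equal coefficient sums cancel in the difference, and -2 = 1 turns the cross terms into plain
    products. *)
Lemma Q_comb_vecB (a b s : F) (c e : 'I_d.+1 -> F) :
  \sum_i c i = s -> \sum_i e i = s ->
  Q (comb_vec a c - comb_vec b e) =
    (\sum_i c i ^+ 2 - a ^+ 2) + (\sum_i e i ^+ 2 - b ^+ 2)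
    + \sum_i c i * e i - a * b.
Proof.
move=> cs es; rewrite comb_vecB Q_comb_vec ?sumrB ?cs ?es ?subrr //.
transitivity (\sum_i c i ^+ 2 + \sum_i e i ^+ 2 - 2 * \sum_i c i * e i
    - (a - b) ^+ 2).
  congr (_ - _); rewrite mulr_sumr -big_split -sumrB /=.
  by apply: eq_bigr => i _; ring.
by apply: (eq_mod3 (z := a * b - \sum_i c i * e i)); ring.
Qed.

(* inl {a,b} stands for j + w_a + w_b, inr (a, false) for -w_a and
   inr (a, true) for -j - w_a. *)
Definition Sd_index : finType :=
  ({A : {set 'I_d.+1} | #|A| == 2%N} + 'I_d.+1 * bool)%type.

Definition Sd_level (k : Sd_index) : F :=
  match k with inl _ => 1 | inr (_, b) => - b%:R end.

Definition Sd_coef (k : Sd_index) (i : 'I_d.+1) : F :=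
  match k with
  | inl A => (i \in val A)%:R
  | inr (j, _) => - (i == j)%:R
  end.

Definition Sd_point (k : Sd_index) : 'rV[F]_d :=
  comb_vec (Sd_level k) (Sd_coef k).

Lemma sum_mem (A : {set 'I_d.+1}) : \sum_i (i \in A)%:R = #|A|%:R :> F.
Proof. by rewrite -natr_sum -sum1_card [in RHS]big_mkcond. Qed.

Lemma sum_delta (j : 'I_d.+1) (f : 'I_d.+1 -> F) :
  \sum_i f i * (i == j)%:R = f j.
Proof.
rewrite (bigD1 j) //= eqxx mulr1 big1 ?addr0 // => i /negPf->.
by rewrite mulr0.
Qed.

Lemma sum_Sd_coef (k : Sd_index) : \sum_i Sd_coef k i = - 1.
Proof.
case: k => [[A /= /eqP A2]|[j b]] /=.
  by rewrite sum_mem A2; apply: (eq_mod3 (z := 1)); ring.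
rewrite sumrN (eq_bigr (fun i => 1 * (i == j)%:R)) ?(sum_delta j (fun=> 1)) //.
by move=> i _; rewrite mul1r.
Qed.

(** The value is 1 + |A :&: B| for two pairs, where distinct pairs share at most one element; 2 -
    [j in A] for a pair and a single index; and (1 - b) + (1 - b') + [j = j'] - b b' for two single
    indices. *)
Lemma Q_Sd_pointB (k l : Sd_index) :
  k != l -> Q (Sd_point k - Sd_point l) \in [set 1; 2].
Proof.
rewrite (Q_comb_vecB _ _ (sum_Sd_coef k) (sum_Sd_coef l)).
have sqA (A : {set 'I_d.+1}) : \sum_i ((i \in A)%:R : F) ^+ 2 = #|A|%:R.
  by rewrite -sum_mem; apply: eq_bigr => i _; case: (i \in A);
    rewrite ?expr1n ?expr0n.
have sqD (j : 'I_d.+1) : \sum_i (- (i == j)%:R : F) ^+ 2 = 1.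
  rewrite (eq_bigr (fun i => 1 * (i == j)%:R)) ?(sum_delta j (fun=> 1)) //.
  by move=> i _; rewrite sqrrN mul1r; case: (i == j); rewrite ?expr1n ?expr0n.
have AD (A : {set 'I_d.+1}) (j : 'I_d.+1) :
    \sum_i (i \in A)%:R * - (i == j)%:R = - (j \in A)%:R :> F.
  by rewrite -(sum_delta j (fun i => (i \in A)%:R)) -sumrN;
    apply: eq_bigr => i _; ring.
case: k l => [[A A2]|[j b]] [[B B2]|[j' b']] /=;
  rewrite ?sqA ?sqD ?(eqP A2) ?(eqP B2).
- move=> AB; have -> : \sum_i (i \in A)%:R * (i \in B)%:R = #|A :&: B|%:R :> F.
    by rewrite -sum_mem; apply: eq_bigr => i _; rewrite inE -natrM mulnb.
  have : (#|A :&: B| < 2)%N.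
    rewrite ltnNge; apply: contra AB => AB; apply/eqP; congr inl;
      apply: val_inj => /=.
    have /eqP <- : A :&: B == A by rewrite eqEcard subsetIl (eqP A2).
    by apply/eqP; rewrite eqEcard subsetIr (eqP B2).
  case: #|_| => [|[|//]] _; rewrite !inE; apply/orP; [left|right];
    apply/eqP => /=; ring.
- move=> _; rewrite AD !inE; case: (_ \in _); case: b'; apply/orP;
   [left|left|right|right]; apply/eqP => /=; ring.
- move=> _; under eq_bigr do rewrite mulrC.
  rewrite AD !inE; case: (_ \in _); case: b; apply/orP;
   [left|left|right|right]; apply/eqP => /=; ring.
under eq_bigr do rewrite mulrN.
rewrite sumrN sum_delta.
case: (eqVneq j' j) => [->|_] /=; rewrite !inE.
  by case: b b' => [] [] => [/eqP//|_|_|/eqP//]; apply/orP; right;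
    apply/eqP => /=; ring.
case: b b' => [] [] _; apply/orP; [right|left|left|right]; apply/eqP => /=;
  [apply: (eq_mod3 (z := -1))|..]; ring.
Qed.

(** Distinct indices give points at squared distance 1 or 2, both nonzero. *)
Lemma Sd_point_inj : injective Sd_point.
Proof.
move=> k l kl; apply/eqP; apply/negP => /negP/Q_Sd_pointB.
rewrite kl subrr /Q big1 => [|i _]; last by rewrite mxE expr0n.
by rewrite !inE ![0 == _]eq_sym oner_eq0 (negPf two_neq0).
Qed.

(** * Cardinality and identification with [Sd] *)

(** There are C(d+1, 2) + 2 (d+1) indices, and Pascal's rule absorbs one d+1 into C(d+2, 2). *)
Lemma card_Sd_index : #|Sd_index| = LRS_bound d.
Proof.
rewrite card_sum card_sig card_prod card_bool card_ord /LRS_bound addn2.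
have -> : #|[pred A : {set 'I_d.+1} | #|A| == 2%N]| = 'C(d.+1, 2).
  by rewrite -[in RHS](card_ord d.+1) -card_draws cardsE.
by rewrite [in RHS]binS bin1 muln2 -addnn -!addnA addn1.
Qed.

Lemma Sd_pointE0 b : Sd_point (inr (ord0, b)) = (1 - b%:R) *: ones F d.
Proof.
apply/rowP => j; rewrite !mxE /=; ring.
Qed.

Lemma Sd_pointES i b :
  Sd_point (inr (lift ord0 i, b)) = - stdvec F i - b%:R *: ones F d.
Proof.
apply/rowP => j; rewrite !mxE /= (inj_eq lift_inj) -!val_eqE /=; ring.
Qed.

Lemma Sd_index_pairP (A : {A : {set 'I_d.+1} | #|A| == 2%N}) :
  (exists i : 'I_d, val A = [set ord0; lift ord0 i]) \/
  (exists i j : 'I_d, (i < j)%N /\ val A = [set lift ord0 i; lift ord0 j]).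
Proof.
case: A => /= A /cards2P[a [b [ab ->]]].
wlog lt_ab : a b ab / (a < b)%N => [H|].
  case: (ltngtP a b) (ab) => [lt_ab _|lt_ba _|/val_inj->]; last by rewrite eqxx.
    exact: H.
  by rewrite setUC; apply: H; rewrite // eq_sym.
case: (unliftP ord0 b) lt_ab => [j ->|->] //.
by case: (unliftP ord0 a) => [i ->|->] lt_ab;
  [right; exists i, j|left; exists j].
Qed.

Definition Sd_pair (A : {set 'I_d.+1}) (A2 : #|A| == 2%N) : Sd_index :=
  inl (exist (fun A : {set 'I_d.+1} => #|A| == 2%N) A A2).

Lemma Sd_pointP0 i (A2 : #|[set ord0; lift ord0 i]| == 2%N) :
  Sd_point (Sd_pair A2) = stdvec F i.
Proof.
apply/rowP => j; rewrite !mxE /= !inE eqxx (inj_eq lift_inj) -!val_eqE /=; ring.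
Qed.

Lemma Sd_pointPS i j (A2 : #|[set lift ord0 i; lift ord0 j]| == 2%N) :
  i != j -> Sd_point (Sd_pair A2) = uvec F i j.
Proof.
move=> ij; apply/rowP => k; rewrite !mxE /= !inE !(inj_eq lift_inj) /=.
case: (eqVneq k i) => [->|_]; first rewrite (negPf ij) /=.
  by apply: (eq_mod3 (z := 1)); ring.
case: (k == j) => /=; last by ring.
by apply: (eq_mod3 (z := 1)); ring.
Qed.

(** The dictionary is: j + w_0 + w_i = e_i, -w_0 = j, -j - w_0 = 0 and -w_i = -e_i in any
    characteristic; j + w_i + w_k = u_ik and -j - w_i = v_i because 2 = -1. *)
Lemma Sd_image : Sd F d = [set Sd_point k | k : Sd_index].
Proof.
have two : 2 = -1 :> F by apply: (eq_mod3 (z := 1)); ring.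
have vE i : vvec F i = Sd_point (inr (lift ord0 i, true)).
  by rewrite Sd_pointES scale1r /vvec two scaleN1r addrC.
have cP (i j : 'I_d.+1) : i != j -> #|[set i; j]| == 2%N.
  by rewrite cards2 => ->.
apply/eqP; rewrite eqEsubset; apply/andP; split; apply/subsetP => x.
  rewrite !inE -!orbA => /or4P[/eqP->|/eqP->|/imsetP[i _ ->]|].
  - by apply/imsetP; exists (inr (ord0, true));
    rewrite // Sd_pointE0 subrr scale0r.
  - by apply/imsetP; exists (inr (ord0, false));
    rewrite // Sd_pointE0 subr0 scale1r.
  - have A2 := cP _ _ (neq_lift ord0 i).
    by apply/imsetP; exists (Sd_pair A2); rewrite // Sd_pointP0.
  case/or3P => [/imsetP[i _ ->]|/imset2P[i j _]|/imsetP[i _ ->]].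
  - by apply/imsetP; exists (inr (lift ord0 i, false));
    rewrite // Sd_pointES scale0r subr0.
  - rewrite inE /= => ij ->; have ne : i != j by rewrite neq_ltn ij.
    have A2 : #|[set lift ord0 i; lift ord0 j]| == 2%N.
      by apply: cP; rewrite (inj_eq lift_inj).
    by apply/imsetP; exists (Sd_pair A2); rewrite // Sd_pointPS.
  by apply/imsetP; exists (inr (lift ord0 i, true)).
case/imsetP=> [[A|[k b]] _ ->]; rewrite !inE -!orbA.
  case: (Sd_index_pairP A) => [[i]|[i [j [ij]]]]; case: A => /= A A2 AE;
    subst A;
    rewrite -[inl _]/(Sd_pair A2).
    by rewrite Sd_pointP0; apply/or4P/Or43/imset_f.
  rewrite Sd_pointPS ?neq_ltn ?ij //; apply/or4P/Or44/or3P/Or32/imset2P.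
  by exists i j; rewrite ?inE.
case: (unliftP ord0 k) => [i ->|->].
  case: b; first by rewrite -vE; apply/or4P/Or44/or3P/Or33/imset_f.
  rewrite Sd_pointES scale0r subr0; apply/or4P/Or44/or3P/Or31/imsetP.
  by exists i.
by rewrite Sd_pointE0; case: b;
  rewrite ?subrr ?scale0r ?subr0 ?scale1r eqxx ?orbT.
Qed.

End Char3.

(** * Both distances occur, and the bound is sharp in infinitely many dimensions *)

Theorem theorem3p1 (F : finFieldType) (r : nat) (r_ge1 : (1 <= r)%N)
    (cardF : #|F| = (3 ^ r)%N) :
  [/\ (forall d : nat, (2 <= d)%N -> d = 2 %[mod 3] ->
         [/\ two_distance (Sd F d),
             sq_dists (Sd F d) = [set 1; 2],
             (1 : F) != 0,
             (2 : F) != 0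
           & #|Sd F d| = LRS_bound d]),
      (forall (d : nat) (S : {set 'rV[F]_d}),
         two_distance S -> 0 \notin sq_dists S -> (#|S| <= LRS_bound d)%N)
    & (forall N : nat, exists d : nat, (N < d)%N /\
         exists S : {set 'rV[F]_d},
           [/\ two_distance S, 0 \notin sq_dists S & #|S| = LRS_bound d])].
Proof.
have three0 : 3 = 0 :> F.
  by apply/eqP; have := card_finPcharP cardF (isT : prime 3) => /andP[].
have two0 := two_neq0 three0.
have dist d : (2 <= d)%N -> d = 2 %[mod 3] ->
    sq_dists (Sd F d) = [set 1; 2] /\ #|Sd F d| = LRS_bound d.
  move=> d_ge2 d_mod.
  have d2 : d%:R = 2 :> F.
    by rewrite (divn_eq d 3) d_mod natrD natrM three0 mulr0 add0r.
  split; last first.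
    by rewrite Sd_image // (card_imset _ (Sd_point_inj three0 d2))
      card_Sd_index.
  apply/eqP; rewrite eqEsubset; apply/andP; split; apply/subsetP => z.
    rewrite Sd_image // => /imset2P[x y /imsetP[k _ ->]].
    rewrite inE => /andP[/imsetP[l _ ->] kl] ->.
    by apply: Q_Sd_pointB => //; apply: contraNneq kl => ->.
  have Q0 : Q (0 : 'rV[F]_d) = 0.
    by rewrite /Q big1 // => i _; rewrite mxE expr0n.
  (* As 0 lies in the set, the values 1 and 2 are realised by the norms of e_i and of the all-ones
     vector. *)
  have dist0 x : x \in Sd F d -> Q x != 0 -> Q x \in sq_dists (Sd F d).
    move=> xS Qx; apply/imset2P; exists x 0; rewrite ?subr0 //.
    rewrite inE; apply/andP; split; first by rewrite !inE eqxx.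
    by apply: contraNneq Qx => ->; rewrite Q0.
  have Q1 : Q (ones F d) = 2.
    rewrite /Q -d2 -[d in RHS]card_ord -sumr_const.
    by apply: eq_bigr => i _; rewrite mxE expr1n.
  pose i0 := Ordinal (ltnW d_ge2).
  have Qe : Q (stdvec F i0) = 1.
    rewrite /Q (bigD1 i0) //= mxE !eqxx expr1n big1 ?addr0 // => i /negPf ne.
    by rewrite mxE ne andbF expr0n.
  rewrite in_set2 => /orP[]/eqP ->.
    have := dist0 (stdvec F i0); rewrite Qe; apply; last exact: oner_neq0.
    by rewrite !inE imset_f ?orbT.
  have := dist0 (ones F d); rewrite Q1; apply=> //.
  by rewrite !inE eqxx orbT.
have ne12 : (1 : F) != 2.
  by rewrite eq_sym -subr_eq0 (_ : 2 - 1 = 1) ?oner_neq0 //; ring.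
have two d : sq_dists (Sd F d) = [set 1; 2] -> two_distance (Sd F d).
  by rewrite /two_distance => ->; rewrite cards2 ne12.
split=> [d d_ge2 d_mod|d S|N].
- have [dE cE] := dist d d_ge2 d_mod.
  by split=> //; [apply: two | apply: oner_neq0].
- exact: LRS_upper_bound.
(* This dimension exceeds N and is 2 modulo 3. *)
exists (N * 3 + 2)%N; split; first by rewrite addn2 ltnS leqW // leq_pmulr.
have [dE cE] := dist (N * 3 + 2)%N (leq_addl _ _) (modnMDl _ _ _).
exists (Sd F (N * 3 + 2)); split=> //; first exact: two.
by rewrite dE !inE ![0 == _]eq_sym oner_eq0 (negPf two0).
Qed.
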